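(* Let $\mathcal{G}$ be a compact group acting continuously on a sample space $\mathcal{Y}$, let $T : \mathcal{Y} \to \mathbb{R}$ be a measurable test statistic, let $\alpha \in (0,1)$, and let $\varepsilon_\alpha : \mathcal{Y} \to [0,1/\alpha]$ be the group invariance test $$\varepsilon_\alpha(y) = \tfrac{1}{\alpha}\mathbb{I}\{T(y) > q_\alpha^{\overline{G}}[T(\overline{G}y)]\} + \tfrac{c([y])}{\alpha}\mathbb{I}\{T(y) = q_\alpha^{\overline{G}}[T(\overline{G}y)]\}.$$ If a $\mathcal{Y}$-valued random variable $Y$ looks $\mathcal{G}$ invariant through $T$, then $\mathbb{E}_Y[\varepsilon_\alpha(Y) \mid O_Y] = 1$ almost surely, which implies $\mathbb{E}_Y[\varepsilon_\alpha(Y)] = 1$.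
   Context: All spaces are second-countable locally compact Hausdorff, equipped with their Borel $\sigma$-algebras. The orbit of $y$ is $O_y = \{Gy : G \in \mathcal{G}\}$. A measurable orbit selector $y \mapsto [y]$ is fixed, assigning to each $y$ a representative $[y] \in O_y$ depending only on the orbit. $\overline{G} \sim \mathrm{Unif}(\mathcal{G})$ (Haar probability measure), independent of everything else. $q_\alpha^{\overline{G}}[T(\overline{G}y)]$ is the $\alpha$ upper-quantile of the distribution of $T(\overline{G}y)$ with $y$ fixed, i.e. $\inf\{t : \mathbb{P}_{\overline{G}}(T(\overline{G}y) > t) \leq \alpha\}$. The orbit-dependent constant $c([y])$ solves $$c([y])\,\mathbb{P}_{\overline{G}_2}\big(T(\overline{G}_2[y]) = q_\alpha^{\overline{G}}[T(\overline{G}[y])]\big) = \alpha - \mathbb{P}_{\overline{G}_2}\big(T(\overline{G}_2[y]) > q_\alpha^{\overline{G}}[T(\overline{G}[y])]\big),$$ with $\overline{G}, \overline{G}_2 \sim \mathrm{Unif}(\mathcal{G})$ independent, and $c([y]) = 0$ if the probability multiplying it is zero. A random variable $Y$ ''looks $\mathcal{G}$ invariant through $T$'' if, almost surely, the conditional law of $T(\overline{G}Y)$ given $O_Y$ equals the conditional law of $T(Y)$ given $O_Y$. *)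

(* Defs.v *)
From HB Require Import structures.
From mathcomp Require Import all_boot all_order all_algebra.
From mathcomp Require Import all_classical all_reals all_analysis.

Set Implicit Arguments.
Unset Strict Implicit.
Unset Printing Implicit Defensive.
Import Order.TTheory GRing.Theory Num.Theory.
Import numFieldNormedType.Exports.

Local Open Scope classical_set_scope.
Local Open Scope ring_scope.

(* Pointedness is only there because measurable types are pointed in the
   library; the distinguished point plays no role. *)

HB.mixin Record isTopologicalGroup G & PointedTopological G & Group G := {
  mulg_continuous : continuous (fun x : G * G => (x.1 * x.2)%g) ;
  invg_continuous : continuous (fun x : G => (x^-1)%g)
}.

#[short(type="topologicalGroupType")]
HB.structure Definition TopologicalGroup :=
  {G of PointedTopological G & Group G & isTopologicalGroup G}.

Notation borel X := (g_sigma_algebraType (@open X)).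

Record continuous_action (G : topologicalGroupType) (Y : topologicalType)
    (act : G -> Y -> Y) : Prop := {
  act_one : forall y, act 1%g y = y ;
  act_mul : forall g h y, act (g * h)%g y = act g (act h y) ;
  act_continuous : continuous (fun p : G * Y => act p.1 p.2)
}.

(* On a second-countable compact Hausdorff group there is exactly one such
   probability measure, and it is also right-invariant. *)
Definition is_haar_probability (R : realType) (G : topologicalGroupType)
    (mu : probability (borel G) R) : Prop :=
  forall (g : G) (A : set (borel G)), measurable A ->
    mu [set h : G | A (g * h)%g] = mu A.

Definition group_orbit (G Y : Type) (act : G -> Y -> Y) (y : Y) : set Y :=
  range (act^~ y).

(* Quotient topology on the orbit space, i.e. the finest topology making
   [group_orbit act] continuous.  The carrier is all of [set Y]: elements that
   are not orbits are never values of [group_orbit act] and are unconstrained. *)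
Definition orbit_open (G : Type) (Y : topologicalType) (act : G -> Y -> Y) :
    set (set (set Y)) :=
  [set U | open (group_orbit act @^-1` U)].

Notation orbit_space act := (g_sigma_algebraType (orbit_open act)).

Definition orbit_selector (G : Type) (Y : ptopologicalType)
    (act : G -> Y -> Y) (s : Y -> Y) : Prop :=
  [/\ measurable_fun setT (s : borel Y -> borel Y),
      forall y, group_orbit act y (s y) &
      forall y z, group_orbit act y = group_orbit act z -> s y = s z].

Definition independent d d1 d2 (W : measurableType d) (S1 : measurableType d1)
    (S2 : measurableType d2) (R : realType) (P : probability W R)
    (X1 : W -> S1) (X2 : W -> S2) : Prop :=
  forall A B, measurable A -> measurable B ->
    P (X1 @^-1` A `&` X2 @^-1` B) = (P (X1 @^-1` A) * P (X2 @^-1` B))%E.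

(* [k] is a (regular) conditional law of [X] given [O]. *)
Definition is_conditional_law d d1 d2 (W : measurableType d)
    (S : measurableType d1) (V : measurableType d2) (R : realType)
    (P : probability W R) (O : W -> S) (X : W -> V) (k : R.-pker S ~> V) :
    Prop :=
  forall A B, measurable A -> measurable B ->
    P (O @^-1` A `&` X @^-1` B) = (\int[P]_(w in O @^-1` A) k (O w) B)%E.

(* [Z] is a version of E[X | sigma(O)]. *)
Definition is_conditional_expectation d d1 (W : measurableType d)
    (S : measurableType d1) (R : realType) (P : probability W R)
    (O : W -> S) (X Z : W -> R) : Prop :=
  [/\ P.-integrable setT (EFin \o X),
      P.-integrable setT (EFin \o Z),
      forall B : set R, measurable B ->
        g_sigma_algebra_preimage O (Z @^-1` B) &
      forall A : set W, g_sigma_algebra_preimage O A ->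
        (\int[P]_(w in A) (Z w)%:E = \int[P]_(w in A) (X w)%:E)%E].

(* [Gbar] is meant to be uniform on the group and independent of [X].
   Conditional laws of real random variables exist and are a.s. unique, so it
   does not matter which versions are compared. *)
Definition looks_invariant d (W : measurableType d) (R : realType)
    (P : probability W R) (G : topologicalGroupType) (Y : ptopologicalType)
    (act : G -> Y -> Y) (T : Y -> R) (Gbar : W -> G) (X : W -> Y) : Prop :=
  let O := (fun w => group_orbit act (X w)) : W -> orbit_space act in
  exists k1 k2 : R.-pker (orbit_space act) ~> R,
    [/\ is_conditional_law P O (fun w => T (act (Gbar w) (X w))) k1,
        is_conditional_law P O (fun w => T (X w)) k2 &
        {ae P, forall w, forall B : set R,
          measurable B -> k1 (O w) B = k2 (O w) B}].

Definition upper_quantile d (S : measurableType d) (R : realType)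
    (mu : probability S R) (X : S -> R) (alpha : R) : R :=
  inf [set t : R | (mu [set x | (t < X x)%R] <= alpha%:E)%E].

Section group_invariance_test.
Context (R : realType) (G : topologicalGroupType) (Y : ptopologicalType).
Variables (mu : probability (borel G) R) (act : G -> Y -> Y) (T : Y -> R).
Variable alpha : R.

Definition orbit_quantile (y : Y) : R :=
  upper_quantile mu (fun g => T (act g y)) alpha.

(* The solution c of
     c * mu (T (g z) = q) = alpha - mu (T (g z) > q),  q = orbit_quantile z,
   set to 0 when the factor of c vanishes. *)
Definition tie_constant (z : Y) : R :=
  let q := orbit_quantile z in
  let p_eq := fine (mu [set g | T (act g z) = q]) in
  let p_gt := fine (mu [set g | q < T (act g z)]) in
  if p_eq == 0 then 0 else (alpha - p_gt) / p_eq.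

Definition group_invariance_test (s : Y -> Y) (y : Y) : R :=
  alpha^-1 * (orbit_quantile y < T y)%R%:R
  + tie_constant (s y) / alpha * (T y == orbit_quantile y)%R%:R.

End group_invariance_test.

(* Main.v *)
Require Import Defs.
From HB Require Import structures.
From mathcomp Require Import all_boot all_order all_algebra.
From mathcomp Require Import all_classical all_reals all_analysis.
From mathcomp Require Import measurable_realfun.

Set Implicit Arguments.
Unset Strict Implicit.
Unset Printing Implicit Defensive.
Import Order.TTheory GRing.Theory Num.Theory.
Import numFieldNormedType.Exports.

Local Open Scope classical_set_scope.
Local Open Scope ring_scope.

(** The test depends on [y] only through the orbit of [y] and the value [T y]:
    the quantile and the tie-breaking constant are orbit invariants
    ([orbit_quantile_act], [tie_constant_act]), so [eps y] is a function
    [orbit_test] of the pair [(group_orbit act y, T y)].  Looking invariant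
    through [T] says that the pairs [(O, T X)] and [(O, T (Gbar X))] have the
    same joint law ([looks_invariant_joint_law]).  Hence, for every event [A]
    of the orbit, the integral of [eps X] over [A] does not change when [T X]
    is replaced by [T (Gbar X)].  By independence the group element can then
    be integrated out first, with the sample point fixed, and this inner
    integral is
      [alpha^-1 * (P (T > q) + c * P (T = q)) = alpha^-1 * alpha = 1]
    by the choice of [c] ([orbit_test_integral]).  So [eps X] and the constant
    1 have the same integral over every event of the orbit, which is the claim.

    Two points need care.  First, the constants are orbit invariants only
    because the Haar probability is right-invariant, whereas its definition
    gives left invariance.  A Fubini argument gives invariance under inversion
    ([haar_inv]), hence right invariance.

    Second, the quantile and the constant must be measurable for the Borel
    structure of the quotient topology on the orbit space, which is a priori
    coarser than measurability on the sample space together with invariance.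
    Everything is expressed through the orbit law
    [orbit_law A y = mu {g | act g y in A}].  For open [A] it is lower
    semicontinuous in [y] and invariant, hence descends to a Borel function on
    the orbit space; a Dynkin argument extends this to all Borel sets [A]
    ([orbit_law_measurable]).  Since [q y <= t] means that the orbit law of
    [{T > t}] is at most [alpha] ([upper_quantile_leE]), the quantile is
    measurable; the tie-breaking constant is a quotient of orbit laws. *)

(** * Borel structures of second-countable spaces *)

Lemma second_countable_seq (T : topologicalType) : @second_countable T ->
  exists2 b : nat -> set T, forall n, open (b n) &
    forall x U, nbhs x U -> exists2 n, b n x & b n `<=` U.
Proof.
move=> [B cB [Bo Bx]]; have [B0|[f]] := pfcard_geP cB.
  exists (fun=> set0) => [_|x U xU]; first exact: open0.
  by have [V [BV _] _] := Bx x _ xU; rewrite B0 in BV.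
exists f => [n|x U xU]; first by apply: Bo; exact: funS.
have [V [BV Vx] VU] := Bx x _ xU.
by have [n _ fn] := @surj _ _ _ _ f _ BV; exists n; rewrite fn.
Qed.

(** Second countability makes the Borel structure of a product equal to the
    product of the Borel structures, and it presents the orbit law of
    an open set as a limit of measures of finite unions. *)
Lemma open_prod_rectangles (T1 T2 : topologicalType) :
  @second_countable T1 -> @second_countable T2 ->
  forall V : set (T1 * T2), open V ->
  exists A : nat -> set T1, exists B : nat -> set T2,
    [/\ forall n, open (A n), forall n, open (B n) &
      V = \bigcup_n (A n `*` B n)].
Proof.
move=> /second_countable_seq[a ao ab] /second_countable_seq[b bo bb] V Vo.
pose R n := if unpickle n is Some (i, j) then
  if `[< a i `*` b j `<=` V >] then (a i, b j) else (set0, set0)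
  else (set0, set0) : set T1 * set T2.
exists (fst \o R), (snd \o R); split=> [n|n|]; rewrite /R /=.
- by case: unpickle => [[i j]|]; [case: ifP|] => //= *; exact: open0.
- by case: unpickle => [[i j]|]; [case: ifP|] => //= *; exact: open0.
apply/seteqP; split=> [[x y] Vxy|[x y] [n _]].
  have : nbhs (x, y) V by apply: open_nbhs_nbhs.
  move=> [[U1 U2] [/= /ab[i aix aiU] /bb[j bjy bjU]] UV].
  exists (pickle (i, j)) => //=; rewrite /R pickleK.
  case: asboolP => // -[] [x' y'] [/= /aiU ? /bjU ?].
  exact: (UV (x', y')).
rewrite /=; case: unpickle => [[i j]|]; last by case.
by case: asboolP => [ijV|_] [] //= *; apply: ijV.
Qed.

Lemma borel_measurable_fun d (S : measurableType d) (T : ptopologicalType)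
    (f : S -> T) : (forall U : set T, open U -> measurable (f @^-1` U)) ->
  measurable_fun setT (f : S -> borel T).
Proof.
move=> fU; refine (@measurability _ _ S (borel T) setT f _ erefl _).
by move=> _ [U Uo <-]; rewrite setTI; exact: fU.
Qed.

Lemma continuous_borel_measurable (T1 T2 : ptopologicalType) (f : T1 -> T2) :
  continuous f -> measurable_fun setT (f : borel T1 -> borel T2).
Proof.
move=> fc; apply: borel_measurable_fun => U Uo; apply: sub_gen_smallest.
exact: (open_comp (fun x _ => fc x) Uo).
Qed.

Lemma continuous2_borel_measurable (T1 T2 T3 : ptopologicalType)
    (f : T1 * T2 -> T3) :
  @second_countable T1 -> @second_countable T2 -> continuous f ->
  measurable_fun setT (f : (borel T1 * borel T2)%type -> borel T3).
Proof.
move=> T1sc T2sc fc; apply: borel_measurable_fun => U Uo.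
have [A [B [Ao Bo ->]]] :=
  open_prod_rectangles T1sc T2sc (open_comp (fun x _ => fc x) Uo).
by apply: bigcupT_measurable => n; apply: measurableX; exact: sub_gen_smallest.
Qed.

Lemma measurable_fun_superlevel d (S : measurableType d) (R : realType)
    (f : S -> \bar R) : (forall t : R, measurable [set x | (t%:E < f x)%E]) ->
  measurable_fun setT f.
Proof.
move=> ft; apply: (measurability _ (ErealGenOInfty.measurableE R)).
move=> _ [_ [t ->] <-]; rewrite setTI [X in measurable X](_ : _ =
  [set x | (t%:E < f x)%E])//.
by apply/seteqP; split=> x /=; rewrite in_itv/= andbT.
Qed.

(** * Unimodularity of the Haar probability *)

Lemma integral_cst_probability d (S : measurableType d) (R : realType)
    (P : probability S R) (r : \bar R) : (\int[P]_x cst r x = r)%E.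
Proof. by rewrite integral_cst//= probability_setT mule1. Qed.

Section topological_group.
Variables (R : realType) (G : topologicalGroupType).
Hypothesis G_second_countable : @second_countable G.

Lemma borel_invg : measurable_fun setT (fun g : borel G => g^-1%g : borel G).
Proof. by apply: continuous_borel_measurable; exact: invg_continuous. Qed.

Lemma borel_mulg :
  measurable_fun setT (fun p : (borel G * borel G)%type => (p.1 * p.2)%g : borel G).
Proof. by apply: continuous2_borel_measurable => //; exact: mulg_continuous. Qed.

Variable mu : probability (borel G) R.
Hypothesis mu_haar : is_haar_probability mu.

(** The measure of the set of pairs [(x, y)] with [x^-1 * y] in [A] is computed
    by Fubini in both orders.  Left invariance turns the sections at fixed [x]
    into [A], and the sections at fixed [y] into the inverse of [A]. *)
Lemma haar_inv (A : set (borel G)) : measurable A ->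
  mu [set g : G | A (g^-1)%g] = mu A.
Proof.
move=> mA.
pose V := [set p : borel G * borel G | A (p.1^-1 * p.2)%g].
have mV : measurable V.
  have minv1 := measurableT_comp borel_invg (@measurable_fst _ _ (borel G) (borel G)).
  have mpair := measurable_fun_pair minv1 (@measurable_snd _ _ (borel G) (borel G)).
  by rewrite -[V]setTI; exact: (measurableT_comp borel_mulg mpair).
rewrite -[LHS](integral_cst_probability mu) -[RHS](integral_cst_probability mu).
 have := indic_fubini_tonelli mu mu mV.
rewrite indic_fubini_tonelli_FE// indic_fubini_tonelli_GE// => fubini.
transitivity (\int[mu]_x (mu \o ysection V) x)%E.
  apply: eq_integral => y _ /=; rewrite ysectionE.
  have mB : measurable ((fun x : borel G => (x, y)) @^-1` V).
    by rewrite -ysectionE; exact: measurable_ysection.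
  rewrite -(mu_haar y mB); congr (mu _); apply/seteqP.
  by split=> g; rewrite /V/= invgM mulgVK.
rewrite -[LHS]fubini; apply: eq_integral => x _ /=; rewrite xsectionE.
exact: (mu_haar (x^-1)%g mA).
Qed.

(** Inversion exchanges left and right translations. *)
Lemma haar_right_invariant (g : G) (A : set (borel G)) : measurable A ->
  mu [set h : G | A (h * g)%g] = mu A.
Proof.
move=> mA.
have mAr : measurable [set h : borel G | A (h * g)%g].
  rewrite -[X in measurable X]setTI.
  exact: (measurable_fun_pair1 (g : borel G) borel_mulg).
have mAV : measurable [set h : borel G | A (h^-1)%g].
  by rewrite -[X in measurable X]setTI; exact: borel_invg.
rewrite -(haar_inv mAr) -(haar_inv mA) -(mu_haar (g^-1)%g mAV).
by congr (mu _); apply/seteqP; split=> h /=; rewrite invgM invgK.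
Qed.

End topological_group.

(** * Measurability on the orbit space *)

Section orbit_space.
Variables (R : realType) (G : topologicalGroupType) (Y : ptopologicalType).
Hypothesis G_second_countable : @second_countable G.
Hypothesis Y_second_countable : @second_countable Y.
Variable act : G -> Y -> Y.
Hypothesis act_action : continuous_action act.

Lemma orbit_refl y : group_orbit act y y.
Proof. by exists 1%g => //; rewrite (act_one act_action). Qed.

Lemma group_orbit_act g y : group_orbit act (act g y) = group_orbit act y.
Proof.
apply/seteqP; split=> [_ [h _ <-]|_ [h _ <-]].
  by exists (h * g)%g => //; rewrite (act_mul act_action).
by exists (h * g^-1)%g => //; rewrite -(act_mul act_action) mulgVK.
Qed.

(** An orbit invariant function descends to the orbit space by evaluation at a
    chosen point [get S] of the orbit [S]; by invariance its values on orbits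
    are independent of the choice, which can be far from measurable. *)
Lemma orbit_get y : exists g, get (group_orbit act y) = act g y.
Proof. by have [g _ <-] := getI (orbit_refl y); exists g. Qed.

Lemma borel_act : measurable_fun setT
  (fun p : (borel G * borel Y)%type => act p.1 p.2 : borel Y).
Proof.
apply: continuous2_borel_measurable => //; exact: act_continuous.
Qed.

Lemma borel_act1 y : measurable_fun setT (fun g : borel G => act g y : borel Y).
Proof. exact: (measurable_fun_pair1 (y : borel Y) borel_act). Qed.

Lemma borel_group_orbit : measurable_fun setT
  (group_orbit act : borel Y -> orbit_space act).
Proof.
refine (@measurability _ _ (borel Y) (orbit_space act) setT _ _ erefl _).
by move=> _ [U Uo <-]; rewrite setTI; exact: sub_gen_smallest.
Qed.

Variable mu : probability (borel G) R.
Hypothesis mu_haar : is_haar_probability mu.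

(** The law of a uniformly random point of the orbit of [y]. *)
Definition orbit_law (A : set Y) (y : Y) : \bar R := mu [set g | A (act g y)].

Lemma measurable_act (A : set Y) y : measurable (A : set (borel Y)) ->
  measurable ([set g | A (act g y)] : set (borel G)).
Proof. by move=> mA; rewrite -[X in measurable X]setTI; exact: borel_act1. Qed.

Lemma orbit_law_act (A : set Y) g y : measurable (A : set (borel Y)) ->
  orbit_law A (act g y) = orbit_law A y.
Proof.
move=> mA; rewrite /orbit_law.
rewrite -(haar_right_invariant G_second_countable mu_haar g
  (measurable_act y mA)); congr (mu _).
by apply/seteqP; split=> h /=; rewrite (act_mul act_action).
Qed.

Lemma orbit_law_get (A : set Y) y : measurable (A : set (borel Y)) ->
  orbit_law A (get (group_orbit act y)) = orbit_law A y.
Proof. by move=> mA; have [g ->] := orbit_get y; exact: orbit_law_act. Qed.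

(** The set of pairs [(g, y)] with [act g y] in [A] is a countable union of
    open rectangles [B n `*` C n].  If the orbit law at [y0] exceeds [t], so
    does the measure of the union of finitely many [B i] with [y0] in [C i],
    and these finitely many [C i] still contain all points near [y0]. *)
Lemma orbit_law_lower_semicontinuous (A : set Y) (t : \bar R) : open A ->
  open [set y | (t < orbit_law A y)%E].
Proof.
move=> Ao; pose V := [set p : G * Y | A (act p.1 p.2)].
have act_cont : continuous (fun p : G * Y => act p.1 p.2).
  exact: act_continuous.
have Vo : open V := open_comp (fun x _ => act_cont x) Ao.
have [B [C [Bo Co VE]]] :=
  open_prod_rectangles G_second_countable Y_second_countable Vo.
rewrite openE => y0 /= tA.
pose D n : set (borel G) := [set g | B n g /\ C n y0].
have mD n : measurable (D n).
  have [Cy0|Cy0] := pselect (C n y0).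
    rewrite (_ : D n = B n); first exact: sub_gen_smallest.
    by apply/seteqP; split=> g // [].
  by rewrite (_ : D n = set0)//; apply/seteqP; split=> g // [].
pose U n := \big[setU/set0]_(i < n.+1) D i.
have mU n : measurable (U n) by apply: bigsetU_measurable.
have UE : \bigcup_n U n = [set g | A (act g y0)].
  rewrite bigcup_bigsetU_bigcup; apply/seteqP; split=> [g [n _ [Bn Cn]]|g Ag].
    suff : V (g, y0) by [].
    by rewrite VE; exists n.
  have : V (g, y0) by [].
  by rewrite VE => -[n _ []]; exists n.
have [N tN] : exists N, (t < mu (U N))%E.
  apply: contrapT => /forallNP tU; move: tA; apply/negP; rewrite -leNgt.
  have Ucvg : mu (U n) @[n --> \oo] --> orbit_law A y0.
    rewrite /orbit_law -UE; apply: nondecreasing_cvg_mu => //.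
      exact: bigcupT_measurable.
    move=> n m nm; apply/subsetPset; exact: subset_bigsetU.
  by apply: (cvge_to_le Ucvg); apply: nearW => n; rewrite leNgt; apply/negP; exact: tU.
have : \forall y \near y0, forall i : 'I_N.+1, C i y0 -> C i y.
  apply: filter_forall => i; have [Ci|Ci] := pselect (C i y0).
    have := open_nbhs_nbhs (conj (Co i) Ci).
    by apply: filterS.
  by near=> y.
apply: filterS => y Cy; apply: (lt_le_trans tN); apply: le_measure.
- by rewrite inE.
- rewrite inE (_ : [set g | _] = \bigcup_n [set g | B n g /\ C n y]).
    apply: bigcupT_measurable => n; have [Cny|Cny] := pselect (C n y).
      rewrite (_ : [set g | _] = B n); first exact: sub_gen_smallest.
      by apply/seteqP; split=> g // [].
    by rewrite (_ : [set g | _] = set0)//; apply/seteqP; split=> g // [].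
  apply/seteqP; split=> [g Ag|g [n _ [? ?]]].
    have : V (g, y) by [].
    by rewrite VE => -[n _ []]; exists n.
  suff : V (g, y) by [].
  by rewrite VE; exists n.
- rewrite /U -bigcup_mkord => g [i /= iN [Big Ciy]].
  suff : V (g, y) by [].
  by rewrite VE; exists i => //; split => //; exact: (Cy (Ordinal iN)).
Unshelve. all: by end_near. Qed.

(** For open [A] the superlevel sets are open in the quotient topology, because
    their preimage in the sample space is a superlevel set of the invariant
    function [orbit_law A].  The sets [A] with the property form a Dynkin
    class. *)
Lemma orbit_law_measurable (A : set Y) : measurable (A : set (borel Y)) ->
  measurable_fun setT
    (fun S : orbit_space act => orbit_law A (get (S : set Y))).
Proof.
move=> mA.
refine (@dynkin_induction _ (borel Y) (@open Y)
  (fun A => measurable_fun setT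
    (fun S : orbit_space act => orbit_law A (get (S : set Y))))
  erefl _ _ _ _ _ A mA).
- by move=> U V; exact: openI.
- rewrite (_ : (fun _ => _) = cst 1%E)//.
  by apply/funext => S; rewrite /orbit_law/= -(@probability_setT _ _ _ mu).
- move=> U Uo; apply: measurable_fun_superlevel => t; apply: sub_gen_smallest.
  rewrite /= /orbit_open/= [X in open X](_ : _ = [set y | (t%:E < orbit_law U y)%E]).
    exact: orbit_law_lower_semicontinuous.
  apply/seteqP; split=> y /=; rewrite orbit_law_get//; exact: sub_gen_smallest.
- move=> B mB FB; rewrite (_ : (fun _ => _) =
    (fun S => (cst 1 S - orbit_law B (get (S : set Y)))%E)).
    by apply: emeasurable_funB.
  apply/funext => S; rewrite /orbit_law/= -probability_setC//.
  exact: measurable_act.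
- move=> F mF tF FF; rewrite (_ : (fun _ => _) =
    (fun S => \sum_(0 <= k <oo | k \in xpredT) orbit_law (F k) (get (S : set Y)))%E).
    by apply: ge0_emeasurable_sum => // k S _ _; exact: measure_ge0.
  apply/funext => S; rewrite /orbit_law.
  rewrite (_ : [set g | _] = \bigcup_k [set g | F k (act g (get (S : set Y)))])//.
  rewrite measure_semi_bigcup//.
  + by move=> k; exact: measurable_act.
  + move=> i j _ _ [g [Fi Fj]]; apply: (tF i j) => //.
    by exists (act g (get (S : set Y))).
  + by apply: bigcupT_measurable => k; exact: measurable_act.
Qed.

End orbit_space.

(** * Upper quantiles *)

Section upper_quantile_theory.
Context d (S : measurableType d) (R : realType).
Variables (P : probability S R) (X : S -> R) (alpha : R).
Hypothesis mX : measurable_fun setT X.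
Hypothesis alpha_bounds : 0 < alpha < 1.

Let mXmfun := isMeasurableFun.Build _ _ _ _ _ mX.
Let Xrv : {RV P >-> R} := HB.pack X mXmfun.

Let tail (t : R) := P [set x | t < X x].

Let ccdfE : ccdf Xrv = tail.
Proof.
apply/funext => t; rewrite /ccdf /distribution /pushforward /tail /=.
by congr (P _); apply/seteqP; split=> x /=; rewrite in_itv/= andbT.
Qed.

Let tail_anti s t : s <= t -> (tail t <= tail s)%E.
Proof. by move=> st; rewrite -!ccdfE; exact: ccdf_nonincreasing. Qed.

Let Q := [set t : R | (tail t <= alpha%:E)%E].

Let Q_has_inf : has_inf Q.
Proof.
case/andP: alpha_bounds => a0 a1; split.
  apply: contrapT => /nonemptyPn Q0; move: a0; apply/negP.
  rewrite -leNgt -lee_fin; apply: (cvge_to_ge (cvg_ccdfy0 Xrv)).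
  apply: nearW => t; rewrite ccdfE leNgt; apply/negP => /ltW Qt.
  by have : Q t by []; rewrite Q0.
have [t ta] : exists t : R, (alpha%:E < tail t)%E.
  apply: contrapT => /forallNP nt; move: a1; apply/negP.
  rewrite -leNgt -lee_fin; apply: (cvge_to_le (cvg_ccdfNy1 Xrv)).
  by apply: nearW => t; rewrite ccdfE leNgt; apply/negP.
exists t => u Qu; rewrite leNgt; apply/negP => /ltW/tail_anti tu.
by have := lt_le_trans ta (le_trans tu Qu); rewrite ltxx.
Qed.

(** The tail is right-continuous, so the infimum defining the quantile is
    attained. *)
Lemma upper_quantile_tail_le :
  (P [set x | (upper_quantile P X alpha < X x)%R] <= alpha%:E)%E.
Proof.
have := @ccdf_right_continuous _ _ _ _ Xrv (inf Q); rewrite ccdfE => tcvg.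
apply: (cvge_to_le tcvg); near=> t; have : inf Q < t by near: t; exact: nbhs_right_gt.
by case/(inf_lt Q_has_inf.1) => u Qu /ltW/tail_anti/le_trans; apply.
Unshelve. all: by end_near. Qed.

(** This Galois connection reduces the measurability of the quantile to that of
    the tails. *)
Lemma upper_quantile_leE r :
  (upper_quantile P X alpha <= r) = (P [set x | (r < X x)%R] <= alpha%:E)%E.
Proof.
apply/idP/idP => [/tail_anti/le_trans|ra]; first by apply; exact: upper_quantile_tail_le.
by apply: ge_inf => //; case: Q_has_inf.
Qed.

(** Below the quantile the tail exceeds [alpha]; let the threshold increase to
    the quantile. *)
Lemma upper_quantile_tail_ge :
  (alpha%:E <= P [set x | (upper_quantile P X alpha <= X x)%R])%E.
Proof.
set q := upper_quantile P X alpha.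
pose F n := [set x | q - n.+1%:R^-1 < X x].
have mgt t : measurable [set x | t < X x].
  rewrite (_ : [set x | _] = X @^-1` `]t, +oo[); first by rewrite -[_ @^-1` _]setTI; exact: mX.
  by apply/seteqP; split=> x /=; rewrite in_itv/= andbT.
have FE : \bigcap_n F n = [set x | q <= X x].
  apply/seteqP; split=> x /= Fx.
    rewrite leNgt; apply/negP => /ltr_add_invr[k]; rewrite -ltrBrDr.
    by move=> /(lt_trans (Fx k I)); rewrite ltxx.
  by move=> n _; rewrite /F/= ltrBlDr; apply: (le_lt_trans Fx); rewrite ltrDl.
have Fcvg : P (F n) @[n --> \oo] --> P [set x | q <= X x].
  rewrite -FE; apply: nonincreasing_cvg_mu => //.
  - by rewrite (le_lt_trans (probability_le1 _ _)) ?ltry//; exact: mgt.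
  - by move=> n; exact: mgt.
  - by apply: bigcapT_measurable => n; exact: mgt.
  - move=> m n mn; apply/subsetPset => x; rewrite /F/=; apply: le_lt_trans.
    by rewrite lerB// lef_pV2 ?posrE// ler_nat.
apply: (cvge_to_ge Fcvg); apply: nearW => n; rewrite leNgt; apply/negP => /ltW.
by rewrite -upper_quantile_leE -/q lerBrDr gerDl leNgt invr_gt0 ltr0Sn.
Qed.

End upper_quantile_theory.

(** * The group invariance test as a function of the orbit and the statistic *)

(** Inversion agrees on nonnegative numbers, [0^-1 = 0] included, with the
    power function of exponent -1. *)
Lemma measurable_fun_inv_ge0 (R : realType) d (S : measurableType d) (f : S -> R) :
  (forall x, 0 <= f x) -> measurable_fun setT f ->
  measurable_fun setT (fun x => (f x)^-1).
Proof.
move=> f0 mf; rewrite (_ : (fun _ => _) = (fun x => f x `^ (-1))).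
  exact: (measurableT_comp (measurable_powR _) mf).
by apply/funext => x; rewrite powR_inv1.
Qed.

Section group_invariance_test_theory.
Variables (R : realType) (G : topologicalGroupType) (Y : ptopologicalType).
Hypothesis G_second_countable : @second_countable G.
Hypothesis Y_second_countable : @second_countable Y.
Variable act : G -> Y -> Y.
Hypothesis act_action : continuous_action act.
Variable mu : probability (borel G) R.
Hypothesis mu_haar : is_haar_probability mu.
Variable T : Y -> R.
Hypothesis mT : measurable_fun setT (T : borel Y -> R).
Variable alpha : R.
Hypothesis alpha_bounds : 0 < alpha < 1.

Local Notation q := (orbit_quantile mu act T alpha).
Local Notation tie := (tie_constant mu act T alpha).
Local Notation law := (orbit_law act mu).

Let mTact y : measurable_fun setT (fun g : borel G => T (act g y)).
Proof. exact: measurableT_comp mT (borel_act1 _ _ _ y). Qed.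

Let mact (A : set Y) y (mA : measurable (A : set (borel Y))) :
  measurable ([set g | A (act g y)] : set (borel G)) :=
  measurable_act G_second_countable Y_second_countable act_action y mA.

Let measurable_tail t : measurable ([set y | t < T y] : set (borel Y)).
Proof.
have := measurable_fun_ltr (@measurable_cst _ _ (borel Y) R setT t) mT.
by move=> /(_ measurableT [set true] I); rewrite setTI.
Qed.

Lemma orbit_quantile_act g y : q (act g y) = q y.
Proof.
congr inf; apply/funext => t /=; congr (_ <= _)%E.
exact: (orbit_law_act _ _ _ mu_haar g y (measurable_tail t)).
Qed.

Lemma orbit_quantile_get y : q (get (group_orbit act y)) = q y.
Proof.
have [g ->] := orbit_get act_action y; exact: orbit_quantile_act.
Qed.

Lemma orbit_quantile_measurable :
  measurable_fun setT (fun S : orbit_space act => q (get (S : set Y))).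
Proof.
apply: (measurability _ (RGenOInfty.measurableE R)) => //.
move=> _ [_ [t ->] <-]; rewrite setTI.
have mlaw := orbit_law_measurable G_second_countable Y_second_countable
  act_action mu_haar (measurable_tail t).
have := emeasurable_fun_o_infty measurableT mlaw alpha%:E.
rewrite setTI; congr measurable; apply/seteqP; split=> S /=;
  by rewrite in_itv/= andbT !ltNge upper_quantile_leE.
Qed.

Lemma borel_orbit_quantile : measurable_fun setT (q : borel Y -> R).
Proof.
have -> : q = (fun S : orbit_space act => q (get (S : set Y))) \o group_orbit act.
  by apply/funext => y /=; rewrite orbit_quantile_get.
have mO := @borel_group_orbit G Y act.
exact: (measurableT_comp orbit_quantile_measurable mO).
Qed.

Let above := [set y | q y < T y].
Let tied := [set y | T y = q y].

Let measurable_above : measurable (above : set (borel Y)).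
Proof.
have := measurable_fun_ltr borel_orbit_quantile mT.
by move=> /(_ measurableT [set true] I); rewrite setTI.
Qed.

Let measurable_tied : measurable (tied : set (borel Y)).
Proof.
have := measurable_fun_eqr mT borel_orbit_quantile.
move=> /(_ measurableT [set true] I); rewrite setTI.
by congr measurable; apply/seteqP; split=> y /= /eqP.
Qed.

Let aboveE y : mu [set g | q y < T (act g y)] = law above y.
Proof.
by congr (mu _); apply/seteqP; split=> g; rewrite /above/= orbit_quantile_act.
Qed.

Let tiedE y : mu [set g | T (act g y) = q y] = law tied y.
Proof.
by congr (mu _); apply/seteqP; split=> g; rewrite /tied/= orbit_quantile_act.
Qed.

Let law_fin (A : set Y) y : measurable (A : set (borel Y)) ->
  law A y \is a fin_num.
Proof. by move=> mA; rewrite /orbit_law fin_num_measure//; exact: (mact y mA). Qed.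

(** If ties have probability 0, this quotient is 0 too, as [0^-1 = 0]. *)
Let tieE y : tie y = (alpha - fine (law above y)) / fine (law tied y).
Proof.
rewrite /tie_constant aboveE tiedE.
by case: eqP => // ->; rewrite invr0 mulr0.
Qed.

Let above_tied y : (fine (law above y) <= alpha <=
  fine (law above y) + fine (law tied y)).
Proof.
have mA : measurable [set g : borel G | q y < T (act g y)].
  rewrite (_ : [set _ | _] = [set g | above (act g y)]); first exact: (mact y measurable_above).
  by apply/seteqP; split=> g; rewrite /above/= orbit_quantile_act.
have mB : measurable [set g : borel G | T (act g y) = q y].
  rewrite (_ : [set _ | _] = [set g | tied (act g y)]); first exact: (mact y measurable_tied).
  by apply/seteqP; split=> g; rewrite /tied/= orbit_quantile_act.
rewrite -!lee_fin EFinD !fineK ?law_fin// -aboveE -tiedE; apply/andP; split.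
  exact: upper_quantile_tail_le.
rewrite -measureU//; last first.
  by apply/seteqP; split=> g //= [] /[swap] ->; rewrite ltxx.
rewrite [X in (_ <= mu X)%E](_ : _ = [set g | q y <= T (act g y)]).
  exact: upper_quantile_tail_ge.
apply/seteqP; split=> g /=; first by case=> [/ltW//|->].
by rewrite le_eqVlt => /orP[/eqP ->|]; [right|left].
Qed.

(** When there are no ties, the two quantile inequalities force the tail to be
    exactly [alpha], so the equation for the constant holds in that case
    too. *)
Lemma tie_constant_tied y :
  tie y * fine (law tied y) = alpha - fine (law above y).
Proof.
rewrite tieE; have [p0|p0] := eqVneq (fine (law tied y)) 0; last by rewrite divfK.
rewrite p0 mulr0; apply/esym/eqP; rewrite subr_eq0 eq_le.
by have := above_tied y; rewrite p0 addr0 andbC.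
Qed.

Lemma tie_constant_bounds y : 0 <= tie y <= 1.
Proof.
have [above_le le_tied] := andP (above_tied y).
have tied_ge0 : 0 <= fine (law tied y) by rewrite fine_ge0.
rewrite tieE divr_ge0 ?subr_ge0//=.
have [->|p0] := eqVneq (fine (law tied y)) 0; first by rewrite invr0 mulr0.
by rewrite ler_pdivrMr ?mul1r ?lerBlDl// lt_neqAle eq_sym p0.
Qed.

Lemma tie_constant_act g y : tie (act g y) = tie y.
Proof.
by rewrite !tieE (orbit_law_act _ _ _ mu_haar g y measurable_above)//
  (orbit_law_act _ _ _ mu_haar g y measurable_tied).
Qed.

Lemma tie_constant_get y : tie (get (group_orbit act y)) = tie y.
Proof. by have [g ->] := orbit_get act_action y; exact: tie_constant_act. Qed.

Lemma tie_constant_measurable :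
  measurable_fun setT (fun S : orbit_space act => tie (get (S : set Y))).
Proof.
have mfine (A : set Y) : measurable (A : set (borel Y)) -> measurable_fun setT
    (fun S : orbit_space act => fine (law A (get (S : set Y)))).
  move=> mA; apply: measurableT_comp; first exact: fine_measurable.
  exact: orbit_law_measurable.
rewrite (_ : (fun _ => _) = (fun S : orbit_space act =>
    (alpha - fine (law above (get (S : set Y)))) *
    (fine (law tied (get (S : set Y))))^-1)).
  apply: measurable_funM; first by apply: measurable_funB => //; exact: mfine.
  apply: measurable_fun_inv_ge0; last exact: mfine.
  by move=> S; rewrite fine_ge0.
by apply/funext => S; exact: tieE.
Qed.

(** Unlike [group_invariance_test], this takes the orbit as its argument, so
    that the statistic can be replaced by that of another point of the orbit
    without changing the threshold. *)
Definition orbit_test (S : orbit_space act) (t : R) : R :=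
  alpha^-1 * (q (get (S : set Y)) < t)%R%:R
  + tie (get (S : set Y)) / alpha * (t == q (get (S : set Y)))%R%:R.

Lemma orbit_test_measurable : measurable_fun setT
  (fun p : (orbit_space act * R)%type => orbit_test p.1 p.2).
Proof.
have mq : measurable_fun setT (fun p : (orbit_space act * R)%type =>
    q (get (p.1 : set Y))).
  exact: measurableT_comp orbit_quantile_measurable measurable_fst.
have mbool (b : (orbit_space act * R)%type -> bool) : measurable_fun setT b ->
    measurable_fun setT (fun p => (b p)%:R : R).
  move=> mb; rewrite (_ : (fun _ => _) = (fun p => if b p then 1 else 0 : R)).
    exact: measurable_fun_ifT.
  by apply/funext => p; case: (b p).
apply: measurable_funD; apply: measurable_funM => //.
- by apply: mbool; apply: measurable_fun_ltr.
- apply: measurable_funM => //.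
  exact: measurableT_comp tie_constant_measurable measurable_fst.
- by apply: mbool; apply: measurable_fun_eqr.
Qed.

Lemma orbit_test_bounds S t : 0 <= orbit_test S t <= alpha^-1.
Proof.
have /andP[a0 a1] := alpha_bounds.
have /andP[c0 c1] := tie_constant_bounds (get (S : set Y)).
rewrite /orbit_test; case: ltgtP => _; rewrite ?mulr1 ?mulr0 ?addr0 ?add0r.
- by rewrite invr_ge0 (ltW a0) lexx.
- by rewrite lexx invr_ge0 (ltW a0).
by rewrite divr_ge0 ?(ltW a0)//= ler_piMl// invr_ge0 ltW.
Qed.

(** The value of the integral is
    [(fine (law above y) + tie y * fine (law tied y)) / alpha], and the
    constant was chosen to make the numerator [alpha]. *)
Lemma orbit_test_integral y :
  (\int[mu]_g (orbit_test (group_orbit act y) (T (act g y)))%:E = 1)%E.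
Proof.
have /andP[a0 a1] := alpha_bounds.
have /andP[c0 c1] := tie_constant_bounds y.
have mA := mact y measurable_above.
have mB := mact y measurable_tied.
transitivity (\int[mu]_g ((alpha^-1)%:E * (\1_[set g | above (act g y)] g)%:E +
  (tie y / alpha)%:E * (\1_[set g | tied (act g y)] g)%:E))%E.
  apply: eq_integral => g _.
  rewrite /orbit_test orbit_quantile_get tie_constant_get EFinD !EFinM.
  rewrite !indicE; congr (_ * _ + _ * _)%E; congr ((nat_of_bool _)%:R%:E); apply/idP/idP.
  - by rewrite inE /above/= orbit_quantile_act.
  - by rewrite inE /above/= orbit_quantile_act.
  - by rewrite inE /tied/= orbit_quantile_act => /eqP.
  - by rewrite inE /tied/= orbit_quantile_act => /eqP.
have mind (A : set (borel G)) : measurable A ->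
    measurable_fun setT (fun g => (\1_A g : R)%:E).
  by move=> ?; exact/measurable_EFinP/measurable_indic.
have alphaV : (0 <= (alpha^-1)%:E)%E by rewrite lee_fin invr_ge0 ltW.
have tieV : (0 <= (tie y / alpha)%:E)%E by rewrite lee_fin divr_ge0 // ltW.
rewrite ge0_integralD//; first last.
- by apply: measurable_funeM; exact: mind.
- by move=> g _; rewrite mule_ge0.
- by apply: measurable_funeM; exact: mind.
- by move=> g _; rewrite mule_ge0.
rewrite !ge0_integralZl//; first last.
- exact: mind.
- exact: mind.
rewrite !integral_indic// !setIT.
rewrite -[X in (_ * X + _)%E](fineK (law_fin y measurable_above)).
rewrite -[X in (_ + _ * X)%E](fineK (law_fin y measurable_tied)).
rewrite -!EFinM -EFinD mulrAC tie_constant_tied mulrC -mulrDl addrC subrK.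
by rewrite divff// gt_eqF.
Qed.

End group_invariance_test_theory.

(** * Joint laws and conditional expectations *)

Lemma integral_eq_joint_law d d1 d2 (W : measurableType d)
    (S1 : measurableType d1) (S2 : measurableType d2) (R : realType)
    (P : probability W R) (O : W -> S1) (X1 X2 : W -> S2)
    (f : S1 * S2 -> \bar R) :
  measurable_fun setT O -> measurable_fun setT X1 -> measurable_fun setT X2 ->
  (forall A B, measurable A -> measurable B ->
    P (O @^-1` A `&` X1 @^-1` B) = P (O @^-1` A `&` X2 @^-1` B)) ->
  measurable_fun setT f -> (forall p, 0 <= f p)%E ->
  (\int[P]_w f (O w, X1 w) = \int[P]_w f (O w, X2 w))%E.
Proof.
move=> mO mX1 mX2 X12 mf f0.
pose mOX1 := isMeasurableFun.Build _ _ _ _ _ (measurable_fun_pair mO mX1).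
pose mOX2 := isMeasurableFun.Build _ _ _ _ _ (measurable_fun_pair mO mX2).
pose OX1 : {RV P >-> (S1 * S2)%type} := HB.pack (fun w => (O w, X1 w)) mOX1.
pose OX2 : {RV P >-> (S1 * S2)%type} := HB.pack (fun w => (O w, X2 w)) mOX2.
rewrite -[LHS](ge0_integral_distribution OX1 mf f0).
rewrite -[RHS](ge0_integral_distribution OX2 mf f0).
apply: eq_measure_integral => C mC _.
apply: (measure_unique [set A `*` B | A in measurable & B in measurable]
  (fun=> setT)) => //.
- by rewrite measurable_prod_measurableType.
- move=> _ _ [A1 mA1 [B1 mB1 <-]] [A2 mA2 [B2 mB2 <-]].
  rewrite -setXI; exists (A1 `&` A2); first exact: measurableI.
  by exists (B1 `&` B2) => //; exact: measurableI.
- by move=> _; exists setT => //; exists setT => //; rewrite setXTT.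
- by rewrite bigcup_const//; exists 0%N.
- by move=> _ [A mA [B mB <-]]; exact: X12.
- by move=> _; rewrite (le_lt_trans (probability_le1 _ _)) ?ltry.
Qed.

Lemma integral_independent d d1 d2 (W : measurableType d)
    (S1 : measurableType d1) (S2 : measurableType d2) (R : realType)
    (P : probability W R) (X1 : {RV P >-> S1}) (X2 : {RV P >-> S2})
    (f : S1 * S2 -> \bar R) :
  independent P X1 X2 ->
  measurable_fun setT f -> (forall p, 0 <= f p)%E ->
  (\int[P]_w f (X1 w, X2 w) =
   \int[P]_w \int[distribution P X1]_x f (x, X2 w))%E.
Proof.
move=> X12 mf f0.
have mpair : measurable_fun setT (fun w => (X1 w, X2 w)).
  by apply: measurable_fun_pair.
pose mX12 := isMeasurableFun.Build _ _ _ _ _ mpair.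
pose X : {RV P >-> (S1 * S2)%type} := HB.pack (fun w => (X1 w, X2 w)) mX12.
rewrite -[LHS](ge0_integral_distribution X mf f0).
have mG := @measurable_fun_fubini_tonelli_G _ _ _ _ _ (distribution P X1) f mf f0.
rewrite -[RHS](ge0_integral_distribution X2 mG); last first.
  by move=> y; exact: integral_ge0.
rewrite -(@fubini_tonelli2 _ _ _ _ _ (distribution P X1) (distribution P X2) f mf f0).
apply/esym/eq_measure_integral => C mC _.
apply: (@product_measure_unique _ _ _ _ _ (distribution P X1)
  (distribution P X2) (distribution P X)) => //.
Qed.

Lemma ae_eq0_of_ge0_integral d (W : measurableType d) (R : realType)
    (P : probability W R) (f : W -> R) (D : set W) : measurable D ->
  P.-integrable D (EFin \o f) -> (forall w, D w -> 0 <= f w) ->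
  (\int[P]_(w in D) (f w)%:E = 0)%E -> {ae P, forall w, D w -> f w = 0}.
Proof.
move=> mD intf f0 If0.
have /ae_eq_integral_abs : (\int[P]_(w in D) `|(f w)%:E| = 0)%E.
  rewrite -If0; apply: eq_integral => w /[!inE] Dw.
  by rewrite /= ger0_norm// f0.
move=> /(_ mD (measurable_int _ intf)).
by apply: filterS => w /= + Dw => /(_ Dw) [].
Qed.

(** The events [1 <= Z] and [Z < 1] are determined by [O], so [Z - 1] has
    integral zero over each of them, while having constant sign there. *)
Lemma conditional_expectation_eq1 d d1 (W : measurableType d)
    (S : measurableType d1) (R : realType) (P : probability W R)
    (O : W -> S) (X Z : W -> R) : measurable_fun setT O ->
  is_conditional_expectation P O X Z ->
  (forall A, g_sigma_algebra_preimage O A ->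
    (\int[P]_(w in A) (X w)%:E = P A)%E) ->
  {ae P, forall w, Z w = 1}.
Proof.
move=> mO [_ intZ mZ IZ] IX.
have sub A : g_sigma_algebra_preimage O A -> measurable A.
  by move=> [B mB <-]; exact: mO.
have intD D : measurable D -> P.-integrable D (EFin \o Z).
  by move=> mD; exact: integrableS intZ.
have int1 D : measurable D -> P.-integrable D (EFin \o (cst 1 : W -> R)).
  move=> mD; apply: (integrableS measurableT mD) => //.
  exact: finite_measure_integrable_cst.
have ID D : g_sigma_algebra_preimage O D ->
    (\int[P]_(w in D) (Z w)%:E = \int[P]_(w in D) 1%:E)%E.
  by move=> OD; rewrite IZ// IX// integral_cst ?mul1e//; exact: sub.
have ge1 : g_sigma_algebra_preimage O [set w | 1 <= Z w].
  rewrite (_ : mkset _ = Z @^-1` `[1, +oo[%classic); first exact: mZ.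
  by apply/seteqP; split=> w /=; rewrite in_itv/= andbT.
have lt1 : g_sigma_algebra_preimage O [set w | Z w < 1].
  rewrite (_ : mkset _ = Z @^-1` `]-oo, 1[%classic); first exact: mZ.
  by apply/seteqP; split=> w /=; rewrite in_itv.
have fin D : measurable D -> (\int[P]_(w in D) 1%:E)%E \is a fin_num.
  by move=> mD; rewrite integral_cst// mul1e fin_num_measure.
have intB (f g : W -> R) D : measurable D -> P.-integrable D (EFin \o f) ->
    P.-integrable D (EFin \o g) ->
    P.-integrable D (EFin \o (fun w => f w - g w)).
  move=> mD intf intg; exact: (integrableB mD intf intg).
have aege : {ae P, forall w, 1 <= Z w -> Z w - 1 = 0}.
  apply: (ae_eq0_of_ge0_integral (sub _ ge1)).
  - exact: (intB _ _ _ (sub _ ge1) (intD _ (sub _ ge1)) (int1 _ (sub _ ge1))).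
  - by move=> w /=; rewrite subr_ge0.
  - under eq_integral do rewrite EFinB.
    rewrite integralB_EFin//; last 3 first.
    + exact: sub.
    + exact: intD (sub _ ge1).
    + exact: int1 (sub _ ge1).
    by rewrite ID// subee// fin//; exact: sub.
have aelt : {ae P, forall w, Z w < 1 -> 1 - Z w = 0}.
  apply: (ae_eq0_of_ge0_integral (sub _ lt1)).
  - exact: (intB _ _ _ (sub _ lt1) (int1 _ (sub _ lt1)) (intD _ (sub _ lt1))).
  - by move=> w /ltW; rewrite subr_ge0.
  - under eq_integral do rewrite EFinB.
    rewrite integralB_EFin//; last 3 first.
    + exact: sub.
    + exact: int1 (sub _ lt1).
    + exact: intD (sub _ lt1).
    by rewrite ID// subee// fin//; exact: sub.
move: aege aelt; apply: filterS2 => w Zge Zlt.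
have [/Zge/eqP|/Zlt/eqP] := leP 1 (Z w); rewrite subr_eq0 => /eqP //.
Qed.

(** Integrate the two conditional laws, which agree almost surely, over the
    event [O \in A]. *)
Lemma looks_invariant_joint_law d (W : measurableType d) (R : realType)
    (P : probability W R) (G : topologicalGroupType) (Y : ptopologicalType)
    (act : G -> Y -> Y) (T : Y -> R) (Gbar : W -> G) (X : W -> Y)
    (O := (fun w => group_orbit act (X w)) : W -> orbit_space act) :
  measurable_fun setT O -> looks_invariant P act T Gbar X ->
  forall A B, measurable A -> measurable B ->
    P (O @^-1` A `&` (fun w => T (X w)) @^-1` B) =
    P (O @^-1` A `&` (fun w => T (act (Gbar w) (X w))) @^-1` B).
Proof.
move=> mO [k1 [k2 [k1P k2P k12]]] A B mA mB; rewrite k1P// k2P//.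
have mkO (k : R.-pker (orbit_space act) ~> R) :
    measurable_fun (O @^-1` A) (fun w => k (O w) B).
  apply: measurable_funTS.
  exact: (measurableT_comp (measurable_kernel k B mB) mO).
apply: ae_eq_integral => //; first by rewrite -[_ @^-1` _]setTI; exact: mO.
by apply: filterS k12 => w k12w _; rewrite k12w.
Qed.

(** * Validity of the test conditionally on the orbit *)

Theorem theorem2 (R : realType)
  (G : topologicalGroupType) (Y : ptopologicalType)
  (G_compact : compact [set: G]) (G_hausdorff : hausdorff_space G)
  (G_second_countable : @second_countable G)
  (Y_locally_compact : locally_compact [set: Y])
  (Y_hausdorff : hausdorff_space Y)
  (Y_second_countable : @second_countable Y)
  (act : G -> Y -> Y) (act_action : continuous_action act)
  (mu : probability (borel G) R) (mu_haar : is_haar_probability mu)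
  (s : Y -> Y) (s_selector : orbit_selector act s)
  (T : Y -> R) (T_measurable : measurable_fun setT (T : borel Y -> R))
  (alpha : R) (alpha_bounds : 0 < alpha < 1)
  (d : measure_display) (W : measurableType d) (P : probability W R)
  (X : {mfun W >-> borel Y}) (Gbar : {mfun W >-> borel G})
  (Gbar_uniform : forall A : set (borel G), measurable A ->
     distribution P Gbar A = mu A)
  (Gbar_independent : independent P Gbar X)
  (X_looks_invariant : looks_invariant P act T Gbar X) :
  let eps := group_invariance_test mu act T alpha s in
  let O := (fun w => group_orbit act (X w)) : W -> orbit_space act in
  [/\ forall y, 0 <= eps y <= alpha^-1,
      exists Z : W -> R, is_conditional_expectation P O (eps \o X) Z,
      forall Z : W -> R, is_conditional_expectation P O (eps \o X) Z ->
        {ae P, forall w, Z w = 1} &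
      'E_P[eps \o X]%E = 1%:E].
Proof.
move=> eps O.
have mact : measurable_fun setT
    (fun p : (borel G * borel Y)%type => act p.1 p.2 : borel Y).
  exact: borel_act.
have mX : measurable_fun setT (X : W -> borel Y) by [].
have mG : measurable_fun setT (Gbar : W -> borel G) by [].
have mO : measurable_fun setT O.
  exact: (measurableT_comp (@borel_group_orbit G Y act) mX).
pose phi := @orbit_test R G Y act mu T alpha.
have mphi : measurable_fun setT (fun p : (orbit_space act * R)%type => phi p.1 p.2).
  exact: orbit_test_measurable.
have phi_bounds S t : 0 <= phi S t <= alpha^-1 by exact: orbit_test_bounds.
have epsE y : eps y = phi (group_orbit act y) (T y).
  have [_ s_orbit _] := s_selector; have [g _ sy] := s_orbit y.
  rewrite /eps /group_invariance_test /phi /orbit_test orbit_quantile_get//.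
  by rewrite tie_constant_get// -sy tie_constant_act.
have eps_bounds y : 0 <= eps y <= alpha^-1 by rewrite epsE.
have mTX : measurable_fun setT (fun w => T (X w)).
  exact: (measurableT_comp T_measurable mX).
have mTGX : measurable_fun setT (fun w => T (act (Gbar w) (X w))).
  have mGX := measurable_fun_pair mG mX.
  exact: (measurableT_comp T_measurable (measurableT_comp mact mGX)).
have meps : measurable_fun setT (eps \o X).
  rewrite (_ : eps \o X = (fun w => phi (O w) (T (X w)))); last first.
    by apply/funext => w; exact: epsE.
  exact: (measurableT_comp mphi (measurable_fun_pair mO mTX)).
have subO A : g_sigma_algebra_preimage O A -> measurable A.
  by move=> [B mB <-]; exact: mO.
have int_eps : P.-integrable setT (EFin \o (eps \o X)).
  apply: measurable_bounded_integrable => //.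
    by rewrite (le_lt_trans (probability_le1 _ _)) ?ltry.
  exists alpha^-1; split; first exact: num_real.
  move=> M aM w _ /=; have /andP[e0 ea] := eps_bounds (X w).
  by rewrite ger0_norm// (le_trans ea)// ltW.
have Ieps A : g_sigma_algebra_preimage O A ->
    (\int[P]_(w in A) ((eps \o X) w)%:E = P A)%E.
  move=> [B mB <-]; rewrite setTI.
  pose f (p : orbit_space act * R) : \bar R :=
    ((phi p.1 p.2)%:E * (\1_B p.1)%:E)%E.
  have mind : measurable_fun setT (fun S : orbit_space act => (\1_B S : R)%:E).
    exact/measurable_EFinP/measurable_indic.
  have mf : measurable_fun setT f.
    apply: emeasurable_funM; first exact/measurable_EFinP.
    exact: (measurableT_comp mind measurable_fst).
  have f0 p : (0 <= f p)%E.
    by rewrite mule_ge0 ?lee_fin//; have /andP[] := phi_bounds p.1 p.2.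
  have mOB : measurable (O @^-1` B) by rewrite -[_ @^-1` _]setTI; exact: mO.
  transitivity (\int[P]_w f (O w, T (X w)))%E.
    rewrite integral_mkcond; apply: eq_integral => w _.
    rewrite /patch /f /= epsE indicE.
    rewrite (_ : (w \in O @^-1` B) = (O w \in B))//.
    by case: ifP => _; rewrite ?mule1 ?mule0.
  (* Invariance through [T] replaces the sample by its random translate,
     while the orbit argument stays the same. *)
  rewrite (integral_eq_joint_law mO mTX mTGX
    (looks_invariant_joint_law mO X_looks_invariant) mf f0).
  pose h (p : borel G * borel Y) := f (group_orbit act p.2, T (act p.1 p.2)).
  have mh : measurable_fun setT h.
    have mO2 := measurableT_comp (@borel_group_orbit G Y act)
      (@measurable_snd _ _ (borel G) (borel Y)).
    have mT2 := measurableT_comp T_measurable mact.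
    exact: (measurableT_comp mf (measurable_fun_pair mO2 mT2)).
  transitivity (\int[P]_w h (Gbar w, X w))%E; first by [].
  (* From here on the group element is integrated out with [X w] fixed. *)
  rewrite (integral_independent Gbar_independent mh); last by move=> p; exact: f0.
  transitivity (\int[P]_w (\1_(O @^-1` B) w)%:E)%E; last first.
    by rewrite integral_indic// setIT.
  apply: eq_integral => w _.
  transitivity (\int[mu]_g h (g, X w))%E.
    by apply: eq_measure_integral => C mC _; exact: Gbar_uniform.
  rewrite /h /f /=.
  have mTg : measurable_fun setT (fun g : borel G => T (act g (X w))).
    exact: (measurableT_comp T_measurable (measurable_fun_pair1 (X w) mact)).
  have mphiw := measurable_fun_pair2 (O w) mphi.
  rewrite ge0_integralZr//; first last.
  - by move=> g _; rewrite lee_fin; have /andP[] := phi_bounds (O w) (T (act g (X w))).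
  - by apply/measurable_EFinP; exact: (measurableT_comp mphiw mTg).
  by rewrite orbit_test_integral// mul1e.
have OT : g_sigma_algebra_preimage O setT.
  by exists setT => //; rewrite preimage_setT setTI.
split=> //.
- exists (cst 1); split=> //.
  + exact: finite_measure_integrable_cst.
  + move=> B mB; rewrite preimage_cst; case: ifP => _; first exact: OT.
    by exists set0 => //; rewrite preimage_set0 setI0.
  + move=> A OA; rewrite Ieps// -[RHS]mul1e.
    exact: (integral_cst P (subO A OA) 1%E).
- by move=> Z Zcond; exact: conditional_expectation_eq1 mO Zcond Ieps.
by rewrite unlock Ieps// probability_setT.
Qed.
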